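(* Let $p$ be an odd prime. In $\mathbf F_p[[X]]$ one has $$X\frac{G'(X)}{G(X)}=\overline{\mathcal H_p(X)}=\overline{\frac{P_p(q(X))+X}{p}},$$ and $$\mathcal W(X):=\sum_{k\ge 0}W_kX^k=\frac{X}{q(X)}\,\overline{\mathcal H_p(X)}.$$ Equivalently (to the second identity), for every $k\ge 0$, $$W_k=[X^k]\left\{\frac{X}{q(X)}\,\overline{\frac{P_p(q(X))+X}{p}}\right\}.$$
   Context: $p$ is an odd prime. The Artin--Hasse exponential is $\operatorname{AH}_p(X)=\exp\left(\sum_{i\ge0}X^{p^i}/p^i\right)=\sum_{n\ge0}u_nX^n\in\mathbf Z_p[[X]]$, and $a_n\in\mathbf F_p$ is the reduction of $u_n$ modulo $p$. Put $$G(X)=\sum_{n\ge0}(-1)^na_{np}X^n\in\mathbf F_p[[X]],\qquad W_k=\sum_{r=0}^k(-1)^r r\,a_{rp}a_{(k-r)p}\in\mathbf F_p.$$ Put $q(X)=\sum_{i\ge0}X^{p^i}\in\mathbf Z[[X]]$ and $P_p(Z)=Z(Z-1)\cdots(Z-p+1)\in\mathbf Z[Z]$. The series $P_p(q(X))+X$ has all coefficients divisible by $p$, and $\mathcal H_p(X):=\frac{P_p(q(X))+X}{p}\in\mathbf Z[[X]]$. A bar denotes coefficientwise reduction modulo $p$; in identities over $\mathbf F_p$, $q(X)$ denotes its reduction modulo $p$, and $X/q(X)\in 1+X\mathbf F_p[[X]]$ since $q(X)=X+\cdots$. $[X^k]$ denotes the coefficient of $X^k$. *)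

(* Defs.v *)
From HB Require Import structures.
From mathcomp Require Import all_boot all_order all_algebra all_field.
From mathcomp Require Import boolp.
Set Implicit Arguments.
Unset Strict Implicit.
Unset Printing Implicit Defensive.
Import GRing.Theory.
Local Open Scope ring_scope.

(* Formal power series R[[X]]; [f n] is the coefficient of X^n in f. *)
Record fps (R : Type) := Fps { coefs :> nat -> R }.

Lemma fpsP (R : Type) (f g : fps R) : (forall n, f n = g n) <-> f = g.
Proof.
by split=> [|-> //]; case: f g => [f] [g] /= efg; congr Fps; apply/funext.
Qed.

HB.instance Definition _ (R : Type) := gen_eqMixin (fps R).
HB.instance Definition _ (R : Type) := gen_choiceMixin (fps R).

Section Ring.
Variable R : comNzRingType.
Implicit Types f g h : fps R.

Definition fps_zero : fps R := Fps (fun=> 0).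
Definition fps_opp f : fps R := Fps (fun n => - f n).
Definition fps_add f g : fps R := Fps (fun n => f n + g n).
Definition fpsC (c : R) : fps R := Fps (fun n => if n == 0%N then c else 0).
Definition fps_mul f g : fps R :=
  Fps (fun n => \sum_(i < n.+1) f i * g (n - i)%N).

Fact fps_addA : associative fps_add.
Proof. by move=> f g h; apply/fpsP => n /=; rewrite addrA. Qed.
Fact fps_addC : commutative fps_add.
Proof. by move=> f g; apply/fpsP => n /=; rewrite addrC. Qed.
Fact fps_add0 : left_id fps_zero fps_add.
Proof. by move=> f; apply/fpsP => n /=; rewrite add0r. Qed.
Fact fps_addN : left_inverse fps_zero fps_opp fps_add.
Proof. by move=> f; apply/fpsP => n /=; rewrite addNr. Qed.
HB.instance Definition _ :=
  GRing.isZmodule.Build (fps R) fps_addA fps_addC fps_add0 fps_addN.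

Definition fps_trunc (m : nat) f : {poly R} := \poly_(i < m) f i.

Lemma coef_fps_trunc m f n : (n < m)%N -> (fps_trunc m f)`_n = f n.
Proof. by move=> nm; rewrite coef_poly nm. Qed.

Lemma fps_mul_trunc m f g n : (n < m)%N ->
  fps_mul f g n = (fps_trunc m f * fps_trunc m g)`_n.
Proof.
move=> nm; rewrite coefM; apply: eq_bigr => i _.
by rewrite !coef_fps_trunc // (leq_ltn_trans _ nm) // ?leq_subr // -ltnS.
Qed.

Fact fps_mulC : commutative fps_mul.
Proof.
by move=> f g; apply/fpsP => n; rewrite !(fps_mul_trunc _ _ (ltnSn n)) mulrC.
Qed.
Fact fps_mulA : associative fps_mul.
Proof.
move=> f g h; apply/fpsP => n.
transitivity ((fps_trunc n.+1 f * fps_trunc n.+1 g * fps_trunc n.+1 h)`_n).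
  rewrite -mulrA coefM; apply: eq_bigr => i _.
  rewrite coef_fps_trunc // -fps_mul_trunc //.
  by rewrite ltnS leq_subr.
rewrite coefM; apply: eq_bigr => i _.
by rewrite -fps_mul_trunc // coef_fps_trunc // ltnS leq_subr.
Qed.
Fact fps_mul1 : left_id (fpsC 1) fps_mul.
Proof.
move=> f; apply/fpsP => n /=; rewrite big_ord_recl /= mul1r subn0.
by rewrite big1 ?addr0 // => i _; rewrite mul0r.
Qed.
Fact fps_mulDl : left_distributive fps_mul fps_add.
Proof.
move=> f g h; apply/fpsP => n /=; rewrite -big_split.
by apply: eq_bigr => i _; rewrite mulrDl.
Qed.
Fact fps_oner_neq0 : fpsC 1 != 0.
Proof.
apply/eqP => /(congr1 (fun f : fps R => f 0%N)) /= /eqP.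
by rewrite oner_eq0.
Qed.
HB.instance Definition _ := GRing.Zmodule_isComNzRing.Build (fps R)
  fps_mulA fps_mulC fps_mul1 fps_mulDl fps_oner_neq0.

Lemma fps_coefD f g n : (f + g) n = f n + g n. Proof. by []. Qed.
Lemma fps_coefN f n : (- f) n = - f n. Proof. by []. Qed.
Lemma fps_coefM f g n : (f * g) n = \sum_(i < n.+1) f i * g (n - i)%N.
Proof. by []. Qed.
Lemma fps_coef0 n : (0 : fps R) n = 0. Proof. by []. Qed.
Lemma fps_coef1 n : (1 : fps R) n = (n == 0%N)%:R.
Proof. by rewrite [LHS]/=; case: eqP. Qed.
Lemma fps_coefCM c f n : (fpsC c * f) n = c * f n.
Proof.
rewrite fps_coefM big_ord_recl /= subn0 big1 ?addr0 // => i _.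
by rewrite mul0r.
Qed.

Definition fpsX : fps R := Fps (fun n => (n == 1%N)%:R).

(* f/X when f 0 = 0. *)
Definition fps_divX f : fps R := Fps (fun n => f n.+1).

Definition fps_deriv f : fps R := Fps (fun n => f n.+1 *+ n.+1).

(* The infinite sum of the F k, for a family such that X^k divides F k: the
   terms with n < k then contribute nothing to the coefficient of X^n. *)
Definition fps_sum (F : nat -> fps R) : fps R :=
  Fps (fun n => \sum_(k < n.+1) F k n).

Lemma fps_coefXM f n : (fpsX * f) n = if n is m.+1 then f m else 0.
Proof.
rewrite fps_coefM; case: n => [|n]; first by rewrite big_ord1 mul0r.
rewrite big_ord_recl mul0r add0r big_ord_recl /= mul1r subSS subn0.
by rewrite big1 ?addr0 // => i _; rewrite mul0r.
Qed.

Lemma fps_coefXn k n : (fpsX ^+ k) n = (n == k)%:R.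
Proof.
elim: k n => [|k IHk] n; first by rewrite expr0 fps_coef1.
by rewrite exprS fps_coefXM; case: n.
Qed.

Lemma fps_divXK f : f 0%N = 0 -> fpsX * fps_divX f = f.
Proof. by move=> f0; apply/fpsP => -[|n]; rewrite fps_coefXM. Qed.

Lemma fps_expr_trunc m f k n : (n < m)%N ->
  (f ^+ k) n = (fps_trunc m f ^+ k)`_n.
Proof.
elim: k n => [|k IHk] n nm; first by rewrite !expr0 fps_coef1 coef1.
rewrite !exprS fps_coefM coefM; apply: eq_bigr => i _.
by rewrite IHk ?coef_fps_trunc // (leq_ltn_trans _ nm) ?leq_subr // -ltnS.
Qed.

End Ring.

Arguments fpsX {R}.

Section Const.
Variable R : comNzRingType.

Fact fpsC_is_zmod_morphism : zmod_morphism (@fpsC R).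
Proof.
by move=> c d; apply/fpsP => -[|n]; rewrite fps_coefD fps_coefN //= subr0.
Qed.
Fact fpsC_is_monoid_morphism : monoid_morphism (@fpsC R).
Proof.
split=> // c d; apply/fpsP => n; rewrite fps_coefCM /=.
by case: eqP; rewrite ?mulr0.
Qed.
HB.instance Definition _ := GRing.isZmodMorphism.Build R (fps R)
  (@fpsC R) fpsC_is_zmod_morphism.
HB.instance Definition _ := GRing.isMonoidMorphism.Build R (fps R)
  (@fpsC R) fpsC_is_monoid_morphism.
End Const.

Section Unit.
Variable R : comUnitRingType.
Implicit Types f g : fps R.

(* The first n coefficients of the inverse of f, from g 0 = 1 / f 0 and
   f 0 * g n = - \sum_(1 <= i <= n) f i * g (n - i). *)
Fixpoint fps_inv_seq f n : seq R :=
  if n is m.+1 then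
    let s := fps_inv_seq f m in
    rcons s (if m == 0%N then (f 0%N)^-1
             else - (f 0%N)^-1 * \sum_(i < m) f i.+1 * s`_(m - i.+1))
  else [::].

Definition fps_unit : {pred fps R} := fun f => f 0%N \is a GRing.unit.
Definition fps_inv f : fps R :=
  if f \in fps_unit then Fps (fun n => (fps_inv_seq f n.+1)`_n) else f.

Fact size_fps_inv_seq f n : size (fps_inv_seq f n) = n.
Proof. by elim: n => //= n IHn; rewrite size_rcons IHn. Qed.

Fact nth_fps_inv_seq f m n : (n < m)%N ->
  (fps_inv_seq f m)`_n = (fps_inv_seq f n.+1)`_n.
Proof.
elim: m => // m IHm; rewrite ltnS leq_eqVlt => /orP[/eqP-> //|nm].
by rewrite [in LHS]/= nth_rcons size_fps_inv_seq nm IHm.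
Qed.

Fact fps_mulVr : {in fps_unit, left_inverse 1 fps_inv *%R}.
Proof.
move=> f fU; rewrite mulrC /fps_inv fU; apply/fpsP => n.
rewrite fps_coef1 fps_coefM big_ord_recl subn0 /= nth_rcons.
rewrite size_fps_inv_seq ltnn eqxx; case: n => [|n] /=.
  by rewrite big_ord0 addr0 divrr.
rewrite mulrA mulrN divrr // mulN1r; apply/eqP.
rewrite addrC subr_eq0; apply/eqP; apply: eq_bigr => i _; congr (_ * _).
rewrite -[RHS]/((fps_inv_seq f n.+1)`_(n.+1 - i.+1)).
rewrite (@nth_fps_inv_seq f n.+1 (n.+1 - i.+1)%N) //.
by rewrite subSS ltnS leq_subr.
Qed.

Fact fps_unitP f g : g * f = 1 -> f \in fps_unit.
Proof.
move=> /fpsP/(_ 0%N); rewrite fps_coefM big_ord1 fps_coef1 => gf1.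
by apply/unitrPr; exists (g 0%N); rewrite mulrC.
Qed.

Fact fps_inv_out : {in [predC fps_unit], fps_inv =1 id}.
Proof. by move=> f /negbTE fU; rewrite /fps_inv fU. Qed.

HB.instance Definition _ := GRing.ComNzRing_hasMulInverse.Build (fps R)
  fps_mulVr fps_unitP fps_inv_out.

End Unit.

Definition map_fps (R S : Type) (u : R -> S) (f : fps R) : fps S :=
  Fps (fun n => u (f n)).

Section MapFps.
Variables (R S : comNzRingType) (u : {rmorphism R -> S}).

Fact map_fps_is_zmod_morphism : zmod_morphism (map_fps u).
Proof. by move=> f g; apply/fpsP => n; rewrite /= rmorphB. Qed.
Fact map_fps_is_monoid_morphism : monoid_morphism (map_fps u).
Proof.
split; first by apply/fpsP => n; rewrite /= [LHS]fun_if rmorph1 rmorph0.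
move=> f g; apply/fpsP => n; rewrite /= rmorph_sum.
by apply: eq_bigr => i _; rewrite rmorphM.
Qed.
HB.instance Definition _ := GRing.isZmodMorphism.Build (fps R) (fps S)
  (map_fps u) map_fps_is_zmod_morphism.
HB.instance Definition _ := GRing.isMonoidMorphism.Build (fps R) (fps S)
  (map_fps u) map_fps_is_monoid_morphism.
End MapFps.

(* exp f = \sum_k f^k / k!, for f 0 = 0. *)
Definition fps_exp (f : fps rat) : fps rat :=
  fps_sum (fun k => fpsC (k`!%:R^-1) * f ^+ k).

Definition AH (p : nat) : fps rat :=
  fps_exp (fps_sum (fun i => fpsC ((p ^ i)%:R^-1) * fpsX ^+ (p ^ i))).

(* AH p n = u_n is a rational number with denominator prime to p, so its class in
   Z_p / p Z_p = F_p is numerator / denominator computed in F_p, which is what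
   [ratr] returns. *)
Definition AH_mod (p n : nat) : 'F_p := ratr (AH p n).

Definition Gser (p : nat) : fps 'F_p :=
  Fps (fun n => (-1) ^+ n * AH_mod p (n * p)).

Definition Wcoef (p k : nat) : 'F_p :=
  \sum_(0 <= r < k.+1)
    (-1) ^+ r * r%:R * AH_mod p (r * p) * AH_mod p ((k - r) * p).

Definition Wser (p : nat) : fps 'F_p := Fps (Wcoef p).

Definition qser (R : comNzRingType) (p : nat) : fps R :=
  fps_sum (fun i => fpsX ^+ (p ^ i)).
Arguments qser R p : clear implicits.

Definition Ppoly (p : nat) : {poly int} := \prod_(j < p) ('X - (j%:Z)%:P).

Definition int_horner (A : comNzRingType) (P : {poly int}) (s : A) : A :=
  (map_poly intr P).[s].

(* Exact when d divides every coefficient; for Hser see Hser_exact. *)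
Definition fps_divz (f : fps int) (d : int) : fps int :=
  Fps (fun n => (f n %/ d)%Z).

Definition Hser (p : nat) : fps int :=
  fps_divz (int_horner (Ppoly p) (qser int p) + fpsX) p%:Z.

Definition red_mod (p : nat) (f : fps int) : fps 'F_p := map_fps intr f.

(* X/q(X), as the inverse of the unit q(X)/X. *)
Definition Xdivq (p : nat) : fps 'F_p := (fps_divX (qser 'F_p p))^-1.

Section Facts.
Variable p : nat.
Hypothesis p_pr : prime p.

Lemma qser_coef (R : comNzRingType) n :
  qser R p n = [exists i : 'I_n.+1, n == (p ^ i)%N]%:R.
Proof.
rewrite /=; under eq_bigr do rewrite fps_coefXn.
case: existsP => [[i /eqP ni]|nex]; last first.
  by rewrite big1 // => i _; case: eqP => // ni; case: nex; exists i; apply/eqP.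
rewrite (bigD1 i) //= -ni eqxx big1 ?addr0 // => j /eqP ji; case: eqP => //.
rewrite {1}ni => /(expnI (prime_gt1 p_pr)) ij; case: ji; exact: val_inj.
Qed.

Lemma qser_pow (R : comNzRingType) i : qser R p (p ^ i)%N = 1.
Proof.
rewrite qser_coef; case: existsP => // -[].
have ip : (i < (p ^ i).+1)%N by rewrite ltnW // ltnS ltn_expl // prime_gt1.
by exists (Ordinal ip) => /=.
Qed.

Lemma qser_npow (R : comNzRingType) n :
  (forall i, n <> (p ^ i)%N) -> qser R p n = 0.
Proof.
by move=> nex; rewrite qser_coef; case: existsP => // -[i /eqP /nex].
Qed.

Lemma qser0 (R : comNzRingType) : qser R p 0%N = 0.
Proof.
by apply: qser_npow => i /esym /eqP; rewrite expn_eq0 (gtn_eqF (prime_gt0 p_pr)).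
Qed.

Lemma map_qser (R S : comNzRingType) (u : {rmorphism R -> S}) :
  map_fps u (qser R p) = qser S p.
Proof. by apply/fpsP => n; rewrite [LHS]/= -[X in u X]/(qser R p n) !qser_coef rmorph_nat. Qed.

Lemma Xdivq_qser : Xdivq p * qser 'F_p p = fpsX.
Proof.
rewrite -[in LHS](fps_divXK (qser0 _)) mulrCA mulVr ?mulr1 //.
have q1 : fps_divX (qser 'F_p p) 0%N = 1.
  by rewrite -[LHS]/(qser 'F_p p (p ^ 0)%N) qser_pow.
by rewrite -[_ \is a _]/(fps_divX (qser 'F_p p) 0%N \is a GRing.unit) q1 unitr1.
Qed.

Lemma expf_Fp (c : 'F_p) : c ^+ p = c.
Proof. by rewrite -[p in c ^+ p](card_Fp p_pr) expf_card. Qed.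

Lemma fps_Fp_expp (f : fps 'F_p) n :
  (f ^+ p) n = if (p %| n)%N then f (n %/ p)%N else 0.
Proof.
rewrite (fps_expr_trunc _ _ (ltnSn n)).
have chp : p \in [pchar {poly 'F_p}] by rewrite pchar_poly pchar_Fp.
have -> : fps_trunc n.+1 f ^+ p = \sum_(i < n.+1) f i *: 'X^(i * p).
  rewrite -(pFrobenius_autE chp) /fps_trunc poly_def rmorph_sum.
  by apply: eq_bigr => i _ /=; rewrite pFrobenius_autE exprZn expf_Fp -exprM.
rewrite coef_sum; under eq_bigr do rewrite coefZ coefXn.
case: ifP => [/dvdnP[m nE]|/negP np]; last first.
  rewrite big1 // => i _; case: eqP => [ni|]; last by rewrite mulr0.
  by case: np; apply/dvdnP; exists i.
have mn : (m < n.+1)%N by rewrite ltnS nE leq_pmulr // prime_gt0.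
have -> : (n %/ p)%N = m by rewrite nE mulnK // prime_gt0.
have i0P (i : 'I_n.+1) : (n == i * p)%N = (i == Ordinal mn).
  by rewrite [in LHS]eq_sym [X in _ == X]nE eqn_pmul2r ?prime_gt0.
rewrite (bigD1 (Ordinal mn)) //= big1 => [|i im].
  by have := i0P (Ordinal mn); rewrite eqxx /= => ->; rewrite mulr1 addr0.
by rewrite i0P (negbTE im) mulr0.
Qed.

Lemma qser_expp : qser 'F_p p ^+ p + fpsX = qser 'F_p p.
Proof.
apply/fpsP => n; rewrite fps_coefD fps_Fp_expp [fpsX n]/=.
have [p0 p1] := (prime_gt0 p_pr, prime_gt1 p_pr).
case: (pselect (exists i, n = (p ^ i)%N)) => [[[|i] ->]|nex].
- rewrite expn0 eqxx dvdn1 (gtn_eqF p1) add0r.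
  by rewrite -[X in qser _ _ X](expn0 p) qser_pow.
- rewrite expnS dvdn_mulr // mulKn // !qser_pow -expnS qser_pow.
  by rewrite -(expn0 p) eqn_exp2l // addr0.
rewrite (qser_npow _ (n := n)); last by move=> i ni; apply: nex; exists i.
case: eqP => [n1|_]; first by case: nex; exists 0%N.
rewrite addr0; case: ifP => // pn; apply: qser_npow => i ni; apply: nex.
by exists i.+1; rewrite expnS -ni mulnC divnK.
Qed.

Lemma prod_Fp : \prod_(j < p) ('X - j%:R%:P) = 'X^p - 'X :> {poly 'F_p}.
Proof.
have := finField_genPoly 'F_p; rewrite card_Fp // => ->.
rewrite -(big_mkord xpredT (fun j => 'X - (j%:R)%:P)) -[X in index_iota _ X](Fp_cast p_pr).
rewrite big_mkord.
by apply: eq_bigr => i _; rewrite natr_Zp.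
Qed.

Lemma Ppoly_qser_mod :
  int_horner (Ppoly p) (qser 'F_p p) = qser 'F_p p ^+ p - qser 'F_p p.
Proof.
have PE : map_poly intr (Ppoly p) = 'X^p - 'X :> {poly 'F_p}.
  rewrite -prod_Fp rmorph_prod; apply: eq_bigr => j _ /=.
  by rewrite rmorphB /= map_polyX map_polyC /= rmorph_nat.
have -> : int_horner (Ppoly p) (qser 'F_p p) =
    (map_poly (@fpsC 'F_p) (map_poly intr (Ppoly p))).[qser 'F_p p].
  by rewrite -map_poly_comp; congr _.[_]; apply: eq_map_poly => c /=;
     rewrite rmorph_int.
by rewrite PE rmorphB /= map_polyXn map_polyX !hornerE.
Qed.

Lemma Hser_exact :
  int_horner (Ppoly p) (qser int p) + fpsX = Hser p *+ p.
Proof.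
set f := _ + _.
have f0 : red_mod p f = 0.
  rewrite /red_mod rmorphD /= /int_horner -horner_map -map_poly_comp /=.
  have -> : map_fps intr (qser int p) = qser 'F_p p by exact: map_qser.
  have -> : map_fps intr (fpsX : fps int) = fpsX :> fps 'F_p.
    by apply/fpsP => n /=; rewrite rmorph_nat.
  have -> : map_poly (map_fps intr \o intr) (Ppoly p) =
      map_poly intr (Ppoly p) :> {poly fps 'F_p}.
    by apply: eq_map_poly => c /=; rewrite rmorph_int.
  by rewrite -/(int_horner _ _) Ppoly_qser_mod addrAC qser_expp subrr.
apply/fpsP => n; have dvd : (p%:Z %| f n)%Z.
  move/fpsP/(_ n): f0 => /= /eqP.
  by rewrite -(dvdz_pcharf (pchar_Fp p_pr)).
have coefMn m : (Hser p *+ m) n = Hser p n *+ m.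
  by elim: m => // m IHm; rewrite !mulrS fps_coefD IHm.
by rewrite coefMn -mulr_natr -[Hser p n]/(f n %/ p%:Z)%Z natz divzK.
Qed.

End Facts.

(* Main.v *)
Require Import Defs.
From HB Require Import structures.
From mathcomp Require Import all_boot all_order all_algebra all_field.
From mathcomp Require Import ring zify.
Set Implicit Arguments.
Unset Strict Implicit.
Unset Printing Implicit Defensive.
Import Order.TTheory GRing.Theory Num.Theory.
Local Open Scope ring_scope.

(** Let theta = X d/dX and split AH(X) = \sum_(j < p) X^j U_j(X^p) according to
    the exponents modulo p. The logarithmic derivative of AH is q, that is
    theta AH = q AH, and q(X) = X + q(X^p). Comparing exponents modulo p turns
    this equation into a triangular system ([secS_rec], [sec0_rec]): with the
    operator D = p theta - q,
      (D + j) U_j = U_(j-1) for 0 < j < p,   and   D U_0 = X U_(p-1).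
    As D (X f) = X (D + p) f, elimination of U_1, ..., U_(p-1) gives
      P_p(D) U_0 = D (D - 1) ... (D - p + 1) U_0 = X U_0  ([falling_op_full]).

    First identity. Modulo p^2 the operator P_p(p theta - q) is explicit
    ([falling_op_expand]): it sends U_0 to
      P_p(-q) U_0 + p (P_p'(-q) theta U_0 - (P_p''/2)(-q) (theta q) U_0).
    Modulo p, P_p(Z) = Z^p - Z, so P_p' = -1, and P_p''/2 = 0 as p is odd; and
    P_p(-q) = X + p H_p(-X), because q is an odd series. Dividing by p leaves
    theta U_0 = H_p(-X) U_0 over F_p, and G(X) = U_0(-X).

    Second identity. W = (theta G) U_0 = H_p(X) U_0(-X) U_0(X), so it remains
    to see that q U_0(X) U_0(-X) = X over F_p ([sec0_negX_qser]). Since the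
    exponents in the logarithm of AH are odd, AH(X) AH(-X) = 1; the part of
    this equation with exponents divisible by p is
      U_0(X) U_0(-X) + X \sum_(0 < j < p) (-1)^(p-j) U_j(X) U_(p-j)(-X) = 1.
    Modulo p the system gives every U_j as U_0 divided by (1 - q) ... (j - q),
    and the left side becomes U_0(X) U_0(-X) times q \sum_(j < p) 1/(q - j),
    where \sum_j 1/(q - j) = P_p'(q) / P_p(q) = 1 / X.

    All this takes place over the local ring Z_(p), hence needs the theorem of
    Artin and Hasse that the coefficients of AH are p-integral ([AH_pint]). It
    follows from AH(X)^p = AH(X^p) exp(p X) ([AH_expp]), where both sides solve
    the same first order equation, since exp(p X) = 1 modulo p and
    f(X)^p = f(X^p) modulo p for every f over Z_(p). *)

(** * Euler operator, parity and sections of power series *)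

Section SeriesOperators.
Variable R : comNzRingType.
Implicit Types f g h : fps R.

Lemma fps_coefMn f k n : (f *+ k) n = f n *+ k.
Proof. by elim: k => // k IHk; rewrite !mulrS fps_coefD IHk. Qed.

Lemma fps_coef_sum (I : Type) (r : seq I) (P : pred I) (F : I -> fps R) n :
  (\sum_(i <- r | P i) F i) n = \sum_(i <- r | P i) F i n.
Proof. by elim/big_rec2: _ => // i x y _ <-. Qed.

Lemma fps_coefXnM k f n :
  (fpsX ^+ k * f) n = if (n < k)%N then 0 else f (n - k)%N.
Proof.
elim: k n => [|k IHk] n; first by rewrite mul1r subn0.
by rewrite exprS -mulrA fps_coefXM; case: n => // n; rewrite IHk ltnS subSS.
Qed.

Lemma fpsX_inj f g : fpsX * f = fpsX * g -> f = g.
Proof.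
by move=> /fpsP fg; apply/fpsP => n; have := fg n.+1; rewrite !fps_coefXM.
Qed.

Definition theta f : fps R := Fps (fun n => f n *+ n).

Fact theta_is_zmod_morphism : zmod_morphism theta.
Proof. by move=> f g; apply/fpsP => n; rewrite /= mulrnBl. Qed.
HB.instance Definition _ :=
  GRing.isZmodMorphism.Build (fps R) (fps R) theta theta_is_zmod_morphism.

Lemma thetaM f g : theta (f * g) = theta f * g + f * theta g.
Proof.
apply/fpsP => n; rewrite fps_coefD !fps_coefM /= -sumrMnl -big_split /=.
apply: eq_bigr => i _; rewrite mulrnAl mulrnAr -mulrnDr.
by rewrite subnKC // -ltnS.
Qed.

Lemma fpsX_deriv f : fpsX * fps_deriv f = theta f.
Proof. by apply/fpsP => -[|n]; rewrite fps_coefXM /= ?mulr0n. Qed.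

Lemma thetaX : theta fpsX = fpsX.
Proof. by apply/fpsP => -[|[|n]]; rewrite /= ?mulr1n ?mul0rn. Qed.

Lemma thetaC c : theta (fpsC c) = 0.
Proof. by apply/fpsP => -[|n]; rewrite /= ?mulr0n ?mul0rn. Qed.

Definition negX f : fps R := Fps (fun n => (-1) ^+ n * f n).

Fact negX_is_zmod_morphism : zmod_morphism negX.
Proof. by move=> f g; apply/fpsP => n; rewrite /= mulrBr. Qed.
Fact negX_is_monoid_morphism : monoid_morphism negX.
Proof.
split; first by apply/fpsP => -[|n] /=; rewrite ?mulr0 ?mulr1.
move=> f g; apply/fpsP => n; rewrite /= big_distrr /=.
apply: eq_bigr => i _; rewrite mulrACA -exprD subnKC //.
by rewrite -ltnS.
Qed.
HB.instance Definition _ := GRing.isZmodMorphism.Build (fps R) (fps R)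
  negX negX_is_zmod_morphism.
HB.instance Definition _ := GRing.isMonoidMorphism.Build (fps R) (fps R)
  negX negX_is_monoid_morphism.

Lemma negXK : involutive negX.
Proof. by move=> f; apply/fpsP => n /=; rewrite mulrA -expr2 sqrr_sign mul1r. Qed.

Lemma negX_theta f : negX (theta f) = theta (negX f).
Proof. by apply/fpsP => n /=; rewrite mulrnAr. Qed.

Lemma negX_fpsX : negX fpsX = - fpsX.
Proof. by apply/fpsP => -[|[|n]] /=; rewrite ?mulr0 ?oppr0 // expr1 mulr1. Qed.

(** The coefficient of X^n in [theta f] is n times that of f, while [h * f]
    involves only lower coefficients of f; so the constant term determines f as
    soon as every n > 0 can be cancelled. *)
Lemma theta_eq_uniq f g h :
    (forall (x : R) n, x *+ n.+1 = 0 -> x = 0) -> h 0%N = 0 ->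
    theta f = h * f -> theta g = h * g -> f 0%N = g 0%N -> f = g.
Proof.
move=> char0 h0 ef eg fg0; apply/fpsP; elim/ltn_ind => -[|n] IHn //.
apply/eqP; rewrite -subr_eq0; apply/eqP/(char0 _ n).
move/fpsP/(_ n.+1): ef => /= ef; move/fpsP/(_ n.+1): eg => /= eg.
rewrite mulrnBl ef eg -sumrB big_ord_recl h0 !mul0r subr0 add0r big1 // => i _.
by rewrite IHn ?subrr // ltn_subrL.
Qed.

Section Sections.
Variable p : nat.
Hypothesis p_gt0 : (0 < p)%N.

(** The substitution f(X^p). *)
Definition expand f : fps R :=
  Fps (fun n => if (p %| n)%N then f (n %/ p)%N else 0).

Lemma coef_expand f n :
  expand f n = if (p %| n)%N then f (n %/ p)%N else 0.
Proof. by []. Qed.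

Lemma fps_coef_expandM f g n :
  (expand f * g) n = \sum_(k < (n %/ p).+1) f k * g (n - k * p)%N.
Proof.
rewrite fps_coefM.
under eq_bigr => i _ do rewrite /= (fun_if ( *%R^~ _)) mul0r.
rewrite -big_mkcond /=.
rewrite (reindex_onto (fun k : 'I_(n %/ p).+1 => inord (k * p) : 'I_n.+1)
                      (fun i : 'I_n.+1 => inord (i %/ p))) /=; last first.
  move=> i pi; apply: val_inj; rewrite /= !inordK ?divnK // ltnS ?leq_div2r //;
    by rewrite -ltnS.
have kp (k : 'I_(n %/ p).+1) : (k * p < n.+1)%N.
  by rewrite ltnS -leq_divRL // -ltnS.
rewrite (eq_bigl xpredT) => [|k]; last first.
  rewrite inordK // dvdn_mull //= mulnK //.
  by apply/eqP/val_inj; rewrite /= inordK.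
by apply: eq_bigr => k _; rewrite inordK // mulnK.
Qed.

Lemma expandM f g : expand (f * g) = expand f * expand g.
Proof.
apply/fpsP => n; rewrite fps_coef_expandM /=; case: ifP => pn; last first.
  rewrite big1 // => k _; rewrite dvdn_subl ?pn ?mulr0 ?dvdn_mull //.
  by rewrite -leq_divRL // -ltnS.
apply: eq_bigr => k _; rewrite dvdn_sub ?dvdn_mull //; congr (_ * g _).
by rewrite divnBr ?dvdn_mull // mulnK.
Qed.

Lemma theta_expand f : theta (expand f) = expand (theta f) *+ p.
Proof.
apply/fpsP => n; rewrite fps_coefMn /=; case: ifP => pn; last by rewrite !mul0rn.
by rewrite -mulrnA divnK.
Qed.

(** The series U_j in f(X) = \sum_(j < p) X^j U_j(X^p). *)
Definition sec j f : fps R := Fps (fun n => f (n * p + j)%N).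

Lemma coef_sec j f n : sec j f n = f (n * p + j)%N. Proof. by []. Qed.

Fact sec_is_zmod_morphism j : zmod_morphism (sec j).
Proof. by []. Qed.
HB.instance Definition _ j :=
  GRing.isZmodMorphism.Build (fps R) (fps R) (sec j) (sec_is_zmod_morphism j).

Lemma sec_expandM j f g : (j < p)%N -> sec j (expand f * g) = f * sec j g.
Proof.
move=> jp; apply/fpsP => n; rewrite coef_sec fps_coef_expandM.
rewrite divnMDl // divn_small // addn0 fps_coefM; apply: eq_bigr => k _ /=.
congr (_ * g _); rewrite mulnBl addnBAC // leq_mul2r -ltnS ltn_ord orbT //.
Qed.

Lemma secSX j f : sec j.+1 (fpsX * f) = sec j f.
Proof. by apply/fpsP => n; rewrite !coef_sec addnS fps_coefXM. Qed.

Lemma sec0Xn j f : (0 < j <= p)%N ->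
  sec 0 (fpsX ^+ j * f) = fpsX * sec (p - j) f.
Proof.
case/andP=> j_gt0 jp; apply/fpsP => -[|n]; rewrite coef_sec.
  by rewrite fps_coefXnM fps_coefXM j_gt0.
rewrite fps_coefXnM fps_coefXM addn0 mulSn ltnNge (leq_trans jp) ?leq_addr //=.
by rewrite addnC addnBA.
Qed.

Lemma sec0X f : sec 0 (fpsX * f) = fpsX * sec p.-1 f.
Proof. by rewrite -[X in X * _]expr1 sec0Xn // subn1. Qed.

Lemma sec_theta j f : sec j (theta f) = theta (sec j f) *+ p + sec j f *+ j.
Proof.
by apply/fpsP => n; rewrite fps_coefD !fps_coefMn /= -mulrnA -mulrnDr.
Qed.

Lemma sec_decomp f : f = \sum_(j < p) expand (sec j f) * fpsX ^+ j.
Proof.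
apply/fpsP => n; rewrite fps_coef_sum.
have nE := divn_eq n p; have np := ltn_pmod n p_gt0.
rewrite (bigD1 (Ordinal np)) // [\big[_/_]_(j | _) _]big1 => [|j /eqP jn].
  rewrite Monoid.mulm1 mulrC fps_coefXnM ltnNge leq_mod.
  have -> : (n - n %% p = n %/ p * p)%N by rewrite {1}nE addnK.
  by rewrite coef_expand dvdn_mull // mulnK // coef_sec -nE.
rewrite mulrC fps_coefXnM; case: ltnP => // jn'; rewrite coef_expand.
case: ifP => // pnj; case: jn; apply: val_inj => /=.
by rewrite -(subnK jn') -modnDml (eqP pnj) add0n modn_small.
Qed.

(** A product X^i X^j with i, j < p contributes to the exponents divisible by p
    when i = j = 0, or when i + j = p, which produces the extra factor X. *)
Lemma sec0M f g : sec 0 (f * g) =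
  sec 0 f * sec 0 g + fpsX * \sum_(1 <= j < p) sec j f * sec (p - j) g.
Proof.
rewrite {1}[f]sec_decomp big_distrl raddf_sum /= -(big_mkord xpredT
  (fun j => sec 0 (expand (sec j f) * fpsX ^+ j * g))) big_ltn //.
rewrite expr0 mulr1 sec_expandM // big_distrr /=; congr (_ + _).
apply: eq_big_nat => j /andP[j0 jp].
rewrite -mulrA (sec_expandM _ _ p_gt0) (@sec0Xn j g); first by rewrite mulrCA.
by rewrite j0 ltnW.
Qed.

Lemma sec_negX j f : odd p -> sec j (negX f) = (-1) ^+ j * negX (sec j f).
Proof.
move=> p_odd; apply/fpsP => n.
rewrite -signr_odd; have -> : (-1) ^+ odd j = fpsC ((-1) ^+ odd j) :> fps R.
  by rewrite rmorph_sign.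
rewrite fps_coefCM /= mulrA -exprD -signr_odd oddD oddM p_odd andbT.
by rewrite -[in RHS](signr_odd _ (_ + n)) oddD oddb addbC.
Qed.

End Sections.
End SeriesOperators.

Lemma fps_coef0M (R : comNzRingType) (f g : fps R) : (f * g) 0%N = f 0%N * g 0%N.
Proof. by rewrite fps_coefM big_ord1. Qed.

(** Changing f from degree n on changes the coefficient of X^n in f^k linearly:
    this isolates the n-th coefficient of a series from a k-th power. *)
Lemma fps_coef_expr_perturb (R : comNzRingType) (t g : fps R) n k :
  (0 < n)%N -> t 0%N = 1 ->
  ((t + fpsX ^+ n * g) ^+ k) n = (t ^+ k) n + g 0%N *+ k.
Proof.
move=> n0 t0; suff [h -> h0] : exists2 h,
    (t + fpsX ^+ n * g) ^+ k = t ^+ k + fpsX ^+ n * h & h 0%N = g 0%N *+ k.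
  by rewrite fps_coefD fps_coefXnM ltnn subnn h0.
elim: k => [|k [h IHh h0]]; first by exists 0; rewrite ?mulr0n // !expr0 mulr0 addr0.
exists (t * h + g * t ^+ k + fpsX ^+ n * (g * h)).
  by rewrite !exprS IHh; ring.
have tk : (t ^+ k) 0%N = 1.
  by elim: k {h IHh h0} => [//|k IHk]; rewrite exprS fps_coef0M t0 IHk mulr1.
by rewrite !fps_coefD fps_coefXnM n0 addr0 !fps_coef0M t0 tk h0 mul1r mulr1 mulrSr.
Qed.

Lemma map_fps_theta (R S : comNzRingType) (u : {rmorphism R -> S}) (f : fps R) :
  map_fps u (theta f) = theta (map_fps u f).
Proof. by apply/fpsP => n; rewrite /= rmorphMn. Qed.

Lemma map_fps_negX (R S : comNzRingType) (u : {rmorphism R -> S}) (f : fps R) :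
  map_fps u (negX f) = negX (map_fps u f).
Proof. by apply/fpsP => n; rewrite /= rmorphM rmorph_sign. Qed.

Lemma map_fps_X (R S : comNzRingType) (u : {rmorphism R -> S}) :
  map_fps u fpsX = fpsX.
Proof. by apply/fpsP => n; rewrite /= rmorph_nat. Qed.

Lemma fps_coef_expr_low (R : comNzRingType) (f : fps R) k n :
  f 0%N = 0 -> (n < k)%N -> (f ^+ k) n = 0.
Proof.
move=> f0; rewrite -[f](fps_divXK f0) exprMn => nk.
by rewrite fps_coefXnM nk.
Qed.

Lemma theta_exprS (R : comNzRingType) (f : fps R) k :
  theta (f ^+ k.+1) = (theta f * f ^+ k) *+ k.+1.
Proof.
elim: k => [|k IHk]; first by rewrite expr1 mulr1.
by rewrite exprS thetaM IHk mulrnAr mulrCA -exprS [RHS]mulrS.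
Qed.

(** * Evaluation of integer polynomials and the series q *)

Section IntHorner.

Lemma PpolyS m : Ppoly m.+1 = ('X - (m%:Z)%:P) * Ppoly m.
Proof. by rewrite /Ppoly big_ord_recr mulrC. Qed.

Variable A : comNzRingType.
Implicit Types (P Q : {poly int}) (s : A).

Lemma int_hornerM P Q s : int_horner (P * Q) s = int_horner P s * int_horner Q s.
Proof. by rewrite /int_horner rmorphM hornerM. Qed.

Lemma int_hornerD P Q s : int_horner (P + Q) s = int_horner P s + int_horner Q s.
Proof. by rewrite /int_horner rmorphD hornerD. Qed.

Lemma int_horner_XsubC (c : nat) s : int_horner ('X - (c%:Z)%:P) s = s - c%:R.
Proof. by rewrite /int_horner rmorphB /= map_polyX map_polyC /= !hornerE. Qed.

Lemma deriv_XsubCM (c : int) Q :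
  (('X - c%:P) * Q)^`() = Q + ('X - c%:P) * Q^`().
Proof. by rewrite derivM derivXsubC mul1r. Qed.

Lemma nderiv2_XsubCM (c : int) Q :
  (('X - c%:P) * Q)^`N(2) = Q^`() + ('X - c%:P) * Q^`N(2).
Proof.
apply/polyP => i; rewrite coefD !mulrBl !(coefB, coef_nderivn, coefXM, coefCM).
rewrite coef_deriv add2n /=; case: i => [|i].
  by rewrite binn !mulr1n add0r.
have -> : 'C(i.+3, 2) = ('C(i.+2, 2) + i.+2)%N by rewrite binS bin1.
rewrite add2n mulrnDr mulrnBl mulrnBl; ring.
Qed.

End IntHorner.

Lemma map_int_horner (A B : comNzRingType) (u : {rmorphism A -> B})
  (P : {poly int}) (s : A) : u (int_horner P s) = int_horner P (u s).
Proof.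
rewrite /int_horner -horner_map -map_poly_comp; congr _.[_].
by apply: eq_map_poly => c /=; rewrite rmorph_int.
Qed.

Lemma expand_qser (R : comNzRingType) (p : nat) : prime p ->
  expand p (qser R p) + fpsX = qser R p.
Proof.
move=> p_pr; apply/fpsP => n; rewrite fps_coefD coef_expand [fpsX n]/=.
have [p0 p1] := (prime_gt0 p_pr, prime_gt1 p_pr).
case: (boolp.pselect (exists i, n = (p ^ i)%N)) => [[[|i] ->]|nex].
- rewrite expn0 eqxx dvdn1 (gtn_eqF p1) add0r.
  by rewrite -[X in qser _ _ X](expn0 p) qser_pow.
- rewrite expnS dvdn_mulr // mulKn // !qser_pow // -expnS qser_pow //.
  by rewrite -(expn0 p) eqn_exp2l // addr0.
rewrite (@qser_npow p p_pr R n); last by move=> i ni; apply: nex; exists i.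
case: eqP => [n1|_]; first by case: nex; exists 0%N.
rewrite addr0; case: ifP => // pn; apply: qser_npow => // i ni; apply: nex.
by exists i.+1; rewrite expnS -ni mulnC divnK.
Qed.

Lemma theta_int_horner (R : comNzRingType) (P : {poly int}) (s : fps R) :
  theta (int_horner P s) = int_horner P^`() s * theta s.
Proof.
elim/poly_ind: P => [|P c IHP].
  by rewrite deriv0 /int_horner rmorph0 horner0 raddf0 mul0r.
have hX : int_horner 'X s = s by rewrite /int_horner map_polyX hornerX.
have hC : theta (int_horner c%:P s) = 0.
  by rewrite /int_horner map_polyC hornerC /= -(rmorph_int (@fpsC R)) thetaC.
rewrite derivD derivM derivX derivC mulr1 addr0 !int_hornerD !int_hornerM.
by rewrite raddfD /= thetaM hC hX IHP; ring.
Qed.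

Lemma negX_qser (R : comNzRingType) p :
  prime p -> odd p -> negX (qser R p) = - qser R p.
Proof.
move=> p_pr p_odd; apply/fpsP => n; rewrite fps_coefN -[LHS]/(_ * qser R p n).
case: (boolp.pselect (exists i, n = (p ^ i)%N)) => [[i ->]|nex].
  by rewrite -signr_odd oddX p_odd orbT expr1 mulN1r.
by rewrite qser_npow ?mulr0 ?oppr0 // => i ni; apply: nex; exists i.
Qed.

(** * The equation satisfied by the section of index zero *)

Section SectionRecursion.
Variables (R : comNzRingType) (p : nat) (p_gt0 : (0 < p)%N).
Implicit Types f g h : fps R.

Section Recursion.
Variables f q : fps R.
Hypothesis qE : expand p q + fpsX = q.
Hypothesis fE : theta f = q * f.
Local Notation U j := (sec p j f).

Lemma sec0_rec : theta (U 0) *+ p - q * U 0 = fpsX * U p.-1.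
Proof.
have := congr1 (sec p 0) fE; rewrite sec_theta mulr0n addr0 => ->.
by rewrite -{1}qE mulrDl raddfD /= sec_expandM // sec0X // addrC addKr.
Qed.

Lemma secS_rec j : (j.+1 < p)%N ->
  theta (U j.+1) *+ p + U j.+1 *+ j.+1 - q * U j.+1 = U j.
Proof.
move=> jp; have := congr1 (sec p j.+1) fE; rewrite sec_theta => ->.
by rewrite -{1}qE mulrDl raddfD /= sec_expandM // secSX // addrC addKr.
Qed.

(** D (D - 1) ... (D - m + 1) applied to U_0, where D = p theta - q. *)
Fixpoint falling_op m : fps R :=
  if m is k.+1 then
    theta (falling_op k) *+ p - q * falling_op k - falling_op k *+ k
  else U 0.

(** For m = 0 this is the equation for D U_0. Each further factor
    D - k, moved across X, becomes D + (p - k), which is exactly the operator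
    that sends U_(p-k) to U_(p-k-1). *)
Lemma falling_op_sec m : (m < p)%N -> falling_op m.+1 = fpsX * U (p - m.+1).
Proof.
elim: m => [|m IHm] mp; first by rewrite /= mulr0n subr0 sec0_rec subn1.
have -> : falling_op m.+2 = theta (falling_op m.+1) *+ p - q * falling_op m.+1
  - falling_op m.+1 *+ m.+1 by [].
rewrite (IHm (ltnW mp)) thetaM thetaX -(@secS_rec (p - m.+2)); last first.
  by rewrite -subSn // subSS ltn_subrL.
have -> : (p - m.+2).+1 = (p - m.+1)%N by rewrite -subSn // subSS.
set V := U _; have -> : V *+ (p - m.+1) = V *+ p - V *+ m.+1.
  by rewrite -mulrnBr // ltnW.
rewrite mulrnDl -(mulr_natr _ m.+1); ring.
Qed.

Lemma falling_op_full : falling_op p = fpsX * U 0.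
Proof. by rewrite -{1}(prednK p_gt0) falling_op_sec ?prednK // subnn. Qed.

(** Taylor expansion of P(p theta - q) in the noncommuting pair theta, q, up to
    p^2. One factor p theta is kept; besides U_0 it differentiates the factors
    -q on its right, and this is where the divided second derivative of P
    comes from. The recursion in m rests on the product rules
    ((X - m) P)' = P + (X - m) P' and ((X - m) P)''/2 = P' + (X - m) P''/2. *)
Lemma falling_op_expand m : exists r : fps R,
  falling_op m = int_horner (Ppoly m) (- q) * U 0
    + (int_horner (Ppoly m)^`() (- q) * theta (U 0)
       - int_horner (Ppoly m)^`N(2) (- q) * theta q * U 0) *+ p
    + r *+ p ^ 2.
Proof.
elim: m => [|m [r IHm]].
  exists 0; rewrite /Ppoly big_ord0 /int_horner derivC nderivnC /=.
  by rewrite rmorph1 raddf0 hornerC horner0; ring.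
set F := Ppoly m in IHm *.
rewrite PpolyS deriv_XsubCM nderiv2_XsubCM -/F !int_hornerD !int_hornerM.
rewrite int_horner_XsubC.
have -> : falling_op m.+1 =
    theta (falling_op m) *+ p - q * falling_op m - falling_op m *+ m by [].
rewrite {}IHm.
set a := int_horner F _; set b := int_horner F^`() _.
set c := int_horner F^`N(2) _.
have ta : theta a = - (b * theta q).
  by rewrite theta_int_horner raddfN mulrN.
rewrite !raddfD /= !raddfMn /= thetaM ta.
exists (theta (b * theta (U 0) - c * theta q * U 0) + theta r *+ p
        - q * r - r *+ m).
ring.
Qed.

End Recursion.
End SectionRecursion.

(** * The differential equation of the Artin-Hasse exponential *)

Section ExpODE.
Implicit Types f : fps rat.

(** In each degree the infinite sum defining exp f agrees with a finite one, to
    which linearity of [theta] applies. *)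
Definition exp_trunc N f : fps rat :=
  \sum_(k < N) fpsC (k`!%:R^-1) * f ^+ k.

Lemma fps_exp_trunc f N n : f 0%N = 0 -> (n < N)%N ->
  fps_exp f n = exp_trunc N f n.
Proof.
move=> f0 nN; rewrite fps_coef_sum [LHS]/=.
rewrite (big_ord_widen_cond _ xpredT
  (fun k => (fpsC (k`!%:R^-1) * f ^+ k) n) nN) big_mkcond /=.
apply: eq_bigr => k _; case: ifPn => //; rewrite -leqNgt => nk.
by rewrite -[RHS]/((fpsC (k`!%:R^-1) * f ^+ k) n) fps_coefCM fps_coef_expr_low ?mulr0.
Qed.

Lemma theta_exp_trunc N f : theta (exp_trunc N.+1 f) = theta f * exp_trunc N f.
Proof.
rewrite raddf_sum big_ord_recl /= expr0 mulr1 thetaC add0r big_distrr /=.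
apply: eq_bigr => k _; rewrite thetaM thetaC mul0r add0r theta_exprS.
have cE : (k.+1)`!%:R^-1 *+ k.+1 = k`!%:R^-1 :> rat.
  by rewrite -[LHS]mulr_natl factS natrM invfM mulrA divff ?mul1r // pnatr_eq0.
by rewrite mulrnAr -mulrnAl -rmorphMn /= cE; ring.
Qed.

Lemma theta_exp f : f 0%N = 0 -> theta (fps_exp f) = theta f * fps_exp f.
Proof.
move=> f0; apply/fpsP => n.
have -> : theta (fps_exp f) n = theta (exp_trunc n.+1 f) n.
  by rewrite -[LHS]/(fps_exp f n *+ n) (@fps_exp_trunc f n.+1).
rewrite theta_exp_trunc !fps_coefM !big_ord_recl /= f0 mul0rn !mul0r !add0r.
apply: eq_bigr => i _; congr (_ * _); symmetry; apply: fps_exp_trunc => //.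
by rewrite /bump /= add1n subnSK // leq_subr.
Qed.

Variable p : nat.
Hypothesis p_pr : prime p.

Lemma AH0 : AH p 0%N = 1.
Proof.
by rewrite -[LHS]/(\sum_(k < 1) _) big_ord1 fps_coefCM expr0 /= mulr1 invr1.
Qed.

Lemma theta_AH : theta (AH p) = qser rat p * AH p.
Proof.
set L := fps_sum (fun i => fpsC ((p ^ i)%:R^-1 : rat) * fpsX ^+ (p ^ i)).
have LE n : L n = \sum_(i < n.+1) (p ^ i)%:R^-1 * (n == p ^ i)%N%:R.
  by apply: eq_bigr => i _; rewrite fps_coefCM fps_coefXn.
have L0 : L 0%N = 0.
  rewrite LE big1 // => i _; rewrite eq_sym expn_eq0.
  by rewrite (gtn_eqF (prime_gt0 p_pr)) mulr0.
rewrite [theta _]theta_exp //; congr (_ * _); apply/fpsP => n.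
rewrite -[LHS]/(L n *+ n) LE -sumrMnl; apply: eq_bigr => i _.
rewrite fps_coefXn; case: eqP => [{2}->|_]; last by rewrite mulr0 mul0rn.
rewrite mulr1 -[LHS]mulr_natl divff // pnatr_eq0 expn_eq0.
by rewrite (gtn_eqF (prime_gt0 p_pr)).
Qed.

Definition exp_pX : fps rat := Fps (fun n => (p ^ n)%:R / n`!%:R).

Lemma theta_exp_pX : theta exp_pX = (fpsX *+ p) * exp_pX.
Proof.
apply/fpsP => n; rewrite mulrnAl fps_coefMn fps_coefXM.
case: n => [|n] /=; first by rewrite mulr0n mul0rn.
rewrite factS expnS !natrM -[LHS]mulr_natr -[RHS]mulr_natr.
have n0 : n.+1%:R != 0 :> rat by rewrite pnatr_eq0.
have f0 : n`!%:R != 0 :> rat by rewrite pnatr_eq0 -lt0n fact_gt0.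
by move: n.+1%:R n`!%:R n0 f0 => a b a0 b0; field; rewrite a0 b0.
Qed.

Lemma rat_char0 (x : rat) n : x *+ n.+1 = 0 -> x = 0.
Proof. by move/eqP; rewrite mulrn_eq0 => /eqP. Qed.

(** Both sides are solutions of theta y = p q(X) y with constant term 1: on the
    right, theta multiplies AH(X^p) by p q(X^p) and exp(p X) by p X, and
    q(X^p) + X = q(X). *)
Lemma AH_expp : AH p ^+ p = expand p (AH p) * exp_pX.
Proof.
have p0 := prime_gt0 p_pr.
apply: (@theta_eq_uniq _ _ _ (qser rat p *+ p)).
- exact: rat_char0.
- by rewrite fps_coefMn qser0 ?mul0rn.
- rewrite -{1 2}(prednK p0) theta_exprS prednK // theta_AH -mulrA -exprS prednK //.
  by rewrite mulrnAl.
- rewrite thetaM theta_expand theta_AH expandM // theta_exp_pX.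
  by rewrite -{2}(expand_qser rat p_pr); ring.
rewrite fps_coef_expandM // div0n big_ord1 AH0 mul1r [RHS]/= divr1.
by rewrite (fps_expr_trunc _ _ (ltnSn 0)) -horner_coef0 horner_exp
  horner_coef0 coef_fps_trunc // AH0 expr1n.
Qed.

End ExpODE.

(** * The local ring of p-integral rationals and its residue field *)

Section Localization.
Variable p : nat.

(** The subring Z_(p) of the rationals. *)
Definition pint : {pred rat} := fun x => coprime p `|denq x|.

(** Denominators need not be reduced in this form, which makes closure under the
    ring operations immediate. *)
Lemma pintP (x : rat) :
  reflect (exists2 d : nat, coprime p d & x * d%:R \is a Num.int) (x \in pint).
Proof.
apply: (iffP idP) => [xp | [d pd /intrP[z xd]]].
  by exists `|denq x|%N => //; rewrite natr_absz normr_denq -numqE intr_int.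
apply: coprime_dvdr pd; rewrite -[d]/(`|d%:Z|%N).
have : (denq x %| numq x * d%:Z)%Z.
  apply/dvdzP; exists z; apply/eqP; rewrite -(eqr_int rat) !rmorphM /= numqE -xd.
  by apply/eqP; rewrite -pmulrn; ring.
by rewrite dvdzE abszM Gauss_dvdr // coprime_sym coprime_num_den.
Qed.

Fact pint_subring_closed : subring_closed pint.
Proof.
split.
- by apply/pintP; exists 1%N; rewrite ?coprimen1 ?mulr1.
- move=> x y /pintP[d pd xd] /pintP[e pe ye].
  apply/pintP; exists (d * e)%N; first by rewrite coprimeMr pd.
  have -> : (x - y) * (d * e)%:R = x * d%:R * e%:R - y * e%:R * d%:R.
    by rewrite natrM; ring.
  by rewrite rpredB // rpredM // natr_int.
- move=> x y /pintP[d pd xd] /pintP[e pe ye].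
  apply/pintP; exists (d * e)%N; first by rewrite coprimeMr pd.
  by rewrite natrM mulrACA rpredM.
Qed.
HB.instance Definition _ :=
  GRing.isSubringClosed.Build rat pint pint_subring_closed.

Record zloc := Zloc { zval :> rat; zval_pint : zval \in pint }.
HB.instance Definition _ := [isSub for zval].
HB.instance Definition _ := [Choice of zloc by <:].
HB.instance Definition _ := [SubChoice_isSubComNzRing of zloc by <:].

Lemma zloc_char0 (x : zloc) n : x *+ n.+1 = 0 -> x = 0.
Proof.
move=> /(congr1 val); rewrite rmorphMn /= => /rat_char0 x0.
by apply: val_inj; rewrite /= x0.
Qed.

End Localization.

Section Reduction.
Variables (p : nat) (p_pr : prime p).
Implicit Types x y : zloc p.

(** Although [ratr] is not additive on all rationals, it is a ring morphism on
    Z_(p). The primality proof is an argument so that the morphism structure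
    can be found from the term. *)
Definition zloc_red (_ : prime p) x : 'F_p := ratr (zval x).
Local Notation red := (zloc_red p_pr).

Lemma natr_Fp_neq0 d : coprime p d -> d%:R != 0 :> 'F_p.
Proof. by rewrite -(dvdn_pcharf (pchar_Fp p_pr)) prime_coprime. Qed.

Lemma red_frac x (d : nat) (z : int) :
  coprime p d -> zval x * d%:R = z%:~R -> red x * d%:R = z%:~R.
Proof.
move=> pd xd; have := natr_Fp_neq0 (zval_pint x : coprime p `|denq x|).
rewrite pmulrn absz_denq => den0; apply: (mulIf den0).
rewrite /zloc_red /ratr mulrAC divfK // -[d%:R]/(d%:Z%:~R) -!rmorphM; congr intmul.
by apply: (intr_inj (R := rat)); rewrite !rmorphM /= numqE -xd pmulrn; ring.
Qed.

Lemma zloc_frac x :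
  exists d : nat, exists2 z : int, coprime p d & zval x * d%:R = z%:~R.
Proof.
by have [d pd /intrP[z xd]] := pintP _ _ (zval_pint x); exists d; exists z.
Qed.

Fact red_is_zmod_morphism : zmod_morphism red.
Proof.
move=> x y; have [d [a pd xd]] := zloc_frac x; have [e [b pe ye]] := zloc_frac y.
have de0 : (d * e)%:R != 0 :> 'F_p by rewrite natr_Fp_neq0 // coprimeMr pd.
apply: (mulIf de0); rewrite (@red_frac _ _ (a * e%:Z - b * d%:Z)).
- rewrite rmorphB !rmorphM /= -(red_frac pd xd) -(red_frac pe ye).
  by rewrite -!pmulrn; ring.
- by rewrite coprimeMr pd.
by rewrite rmorphB !rmorphM /= -xd -ye ?natrM -!pmulrn; ring.
Qed.

Fact red_is_monoid_morphism : monoid_morphism red.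
Proof.
split.
  have := @red_frac 1 1 1; rewrite coprimen1 !mulr1.
  by apply.
move=> x y; have [d [a pd xd]] := zloc_frac x; have [e [b pe ye]] := zloc_frac y.
have de0 : (d * e)%:R != 0 :> 'F_p by rewrite natr_Fp_neq0 // coprimeMr pd.
apply: (mulIf de0); rewrite (@red_frac _ _ (a * b)).
- by rewrite !rmorphM /= -(red_frac pd xd) -(red_frac pe ye) ?natrM; ring.
- by rewrite coprimeMr pd.
by rewrite !rmorphM /= -xd -ye ?natrM; ring.
Qed.

HB.instance Definition _ :=
  GRing.isZmodMorphism.Build (zloc p) 'F_p red red_is_zmod_morphism.
HB.instance Definition _ :=
  GRing.isMonoidMorphism.Build (zloc p) 'F_p red red_is_monoid_morphism.

Lemma red_eq0 x : red x = 0 -> exists y, x = y *+ p.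
Proof.
have [d [a pd xd]] := zloc_frac x => x0.
have := red_frac pd xd; rewrite x0 mul0r => /esym/eqP.
rewrite -(dvdz_pcharf (pchar_Fp p_pr)) => /dvdzP[b aE].
have d0 : d%:R != 0 :> rat.
  rewrite pnatr_eq0; apply: contraTneq pd => ->.
  by rewrite /coprime gcdn0 gtn_eqF // prime_gt1.
have yP : b%:~R / d%:R \in pint p.
  by apply/pintP; exists d; rewrite // divfK.
exists (Zloc yP); apply: val_inj; rewrite rmorphMn /= -mulr_natr.
apply: (mulIf d0); rewrite xd aE rmorphM /= -pmulrn.
by rewrite mulrAC divfK.
Qed.

(** Legendre's formula gives \sum_(k > 0) floor(n / p^k). With a the last
    quotient reached, floor(a / p) + max(1, floor(a / p)) <= max(1, a), since
    p > 1; so adding max(1, a) to the partial sum keeps it at most n, which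
    yields the strict inequality. *)
Lemma logn_fact_lt n : (0 < n)%N -> (logn p n`! < n)%N.
Proof.
move=> n0; rewrite logn_fact //.
suff H m : (\sum_(1 <= k < m.+1) n %/ p ^ k + maxn 1 (n %/ p ^ m) <= n)%N.
  by apply: leq_trans (H n); rewrite -addn1 leq_add2l leq_maxl.
elim: m => [|m IHm]; first by rewrite big_geq // expn0 divn1 add0n geq_max n0 /=.
rewrite big_nat_recr //= -addnA; apply: leq_trans IHm; rewrite leq_add2l.
rewrite expnS mulnC divnMA; move: (n %/ p ^ m)%N => a.
have : (a %/ p * 2 <= a)%N.
  by apply: leq_trans (leq_trunc_div a p); rewrite leq_mul2l prime_gt1 ?orbT.
by lia.
Qed.

(** p^n / n! is divisible by p because n! contains p at most n - 1 times. *)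
Lemma exp_pX_dvd n : (0 < n)%N -> exists y : zloc p, exp_pX p n = zval y *+ p.
Proof.
move=> n0; have [m pm fE] := pfactor_coprime p_pr (fact_gt0 n).
set v := logn p n`! in fE.
have vn : (v < n)%N by rewrite logn_fact_lt.
have yP : (p ^ n.-1)%:R / n`!%:R \in pint p.
  apply/pintP; exists m => //.
  rewrite fE -(subnK (_ : v <= n.-1)%N); last by rewrite -ltnS prednK.
  have nz k : (0 < k)%N -> k%:R != 0 :> rat by rewrite pnatr_eq0 -lt0n.
  have m0 : m%:R != 0 :> rat.
    apply: nz; move: (fact_gt0 n); rewrite fE; by case: (m).
  have pv : (p ^ v)%:R != 0 :> rat by apply: nz; rewrite expn_gt0 prime_gt0.
  have -> : (p ^ (n.-1 - v + v))%:R / (m * p ^ v)%:R * m%:R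
      = (p ^ (n.-1 - v))%:R :> rat.
    by rewrite expnD !natrM invfM; move: m%:R (p ^ v)%:R m0 pv => a b a0 b0;
      field; rewrite a0 b0.
  exact: natr_int.
exists (Zloc yP); rewrite /= -[RHS]mulr_natr mulrAC -natrM -expnSr prednK //.
Qed.

End Reduction.

(** * Integrality of the Artin-Hasse exponential *)

Section Integrality.
Variables (p : nat) (p_pr : prime p).
Local Notation Zp := (zloc p).
Local Notation red := (zloc_red p_pr).

(** Over F_p the Frobenius map gives f(X)^p = f(X^p), and elements of Z_(p) with
    zero reduction are multiples of p. *)
Lemma expr_expand_mod (T : fps Zp) n : exists y, (T ^+ p) n = expand p T n + y *+ p.
Proof.
have [|y yE] := @red_eq0 p p_pr ((T ^+ p) n - expand p T n).
  rewrite rmorphB; apply/eqP; rewrite subr_eq0; apply/eqP.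
  transitivity ((map_fps red T ^+ p) n); first by rewrite -rmorphXn.
  rewrite fps_Fp_expp // coef_expand; case: ifP => // _.
  by rewrite rmorph0.
by exists y; rewrite -yE addrC subrK.
Qed.

(** Induction on n. In AH(X)^p = AH(X^p) exp(p X), the coefficient of X^n on the
    left is p u_n plus the one obtained from u_0, ..., u_(n-1) alone. The
    latter agrees modulo p with the coefficient of AH(X^p), and so does the
    right side. Hence p u_n lies in p Z_(p). *)
Lemma AH_pint n : AH p n \in pint p.
Proof.
elim/ltn_ind: n => n IHn; have [->|n0] := posnP n; first by rewrite AH0 rpred1.
have [p0 p1] := (prime_gt0 p_pr, prime_gt1 p_pr).
have p_neq0 : p%:R != 0 :> rat by rewrite pnatr_eq0 -lt0n.
(* T is AH truncated below degree n, lifted to Z_(p). *)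
pose T : fps Zp := Fps (fun i => if (i < n)%N then insubd 0 (AH p i) else 0).
pose t := map_fps (fun x : Zp => val x) T.
have tE i : (i < n)%N -> t i = AH p i.
  by move=> ni; rewrite /t /= ni insubdK // IHn.
pose g : fps rat := Fps (fun i => AH p (n + i)%N).
have fE : AH p = t + fpsX ^+ n * g.
  apply/fpsP => i; rewrite fps_coefD fps_coefXnM; case: ltnP => ni.
    by rewrite tE // addr0.
  rewrite [t i]/= ltnNge ni /= add0r -[RHS]/(AH p (n + (i - n))%N) subnKC //.
have [y yE] := expr_expand_mod T n.
have tpE : (t ^+ p) n = val (expand p T n) + val y *+ p.
  transitivity (val ((T ^+ p) n)); last by rewrite yE rmorphD rmorphMn.
  by rewrite -[t]/(map_fps val T) -rmorphXn.
have eE i : (i <= n)%N -> expand p (AH p) i = val (expand p T i).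
  move=> ni; rewrite !coef_expand; case: ifP => // _.
  have ipn : (i %/ p < n)%N.
    by apply: leq_ltn_trans (ltn_Pdiv p1 n0); apply: leq_div2r.
  by rewrite -tE.
have lhs : (AH p ^+ p) n = (t ^+ p) n + AH p n *+ p.
  rewrite [in LHS]fE fps_coef_expr_perturb // ?tE ?AH0 //.
  by rewrite -[g 0%N]/(AH p (n + 0)%N) addn0.
have : (AH p ^+ p) n = (expand p (AH p) * exp_pX p) n by rewrite AH_expp.
have Ep0 : exp_pX p 0%N = 1 by rewrite /= divr1.
have -> : (expand p (AH p) * exp_pX p) n =
    \sum_(i < n) expand p (AH p) i * exp_pX p (n - i)%N + expand p (AH p) n.
  rewrite fps_coefM big_ord_recr; congr (_ + _).
  by rewrite -[RHS]mulr1 -Ep0 -(subnn n).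
rewrite lhs tpE eE //; set S := \sum_(i < n) _ => eq_n.
have Sp : S / p%:R \in pint p.
  rewrite /S mulr_suml rpred_sum // => i _.
  have [|z ->] := @exp_pX_dvd p p_pr (n - i)%N; first by rewrite subn_gt0.
  rewrite (eE _ (ltnW (ltn_ord i))) -(mulr_natr (zval z)) mulrA (mulfK p_neq0).
  exact: rpredM (zval_pint _) (zval_pint _).
have -> : AH p n = S / p%:R - val y.
  apply: (mulIf p_neq0); rewrite mulrBl divfK // !mulr_natr.
  by apply: (addrI (val (expand p T n) + val y *+ p)); rewrite eq_n; ring.
exact: rpredB Sp (zval_pint y).
Qed.

Definition AHz : fps Zp := Fps (fun n => Zloc (AH_pint n)).

Lemma map_val_AHz : map_fps val AHz = AH p.
Proof. exact/fpsP. Qed.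

Lemma map_val_inj : injective (map_fps (val : Zp -> rat)).
Proof. by move=> f g /fpsP fg; apply/fpsP => n; apply/val_inj/fg. Qed.

Lemma theta_AHz : theta AHz = qser Zp p * AHz.
Proof.
apply: map_val_inj; rewrite map_fps_theta rmorphM /= map_val_AHz theta_AH //.
by rewrite -(map_qser p_pr (val : {rmorphism Zp -> rat})).
Qed.

(** As q is odd, AH(-X) has logarithmic derivative -q, and the product has
    logarithmic derivative zero. *)
Lemma AHz_negX : odd p -> AHz * negX AHz = 1.
Proof.
move=> p_odd; apply: (@theta_eq_uniq _ _ _ 0) => //.
- exact: zloc_char0.
- by rewrite thetaM -negX_theta theta_AHz rmorphM /= negX_qser //; ring.
- by rewrite -[X in theta X](rmorph1 (@fpsC Zp)) thetaC mul0r.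
have AHz0 : AHz 0%N = 1 by apply: val_inj; apply: AH0.
by rewrite fps_coef0M fps_coef1 -[negX AHz 0%N]/(1 * AHz 0%N) AHz0 !mulr1.
Qed.

End Integrality.

(** * A resolvent identity for descending products *)

Lemma deriv_prod (R : comNzRingType) n (F : nat -> {poly R}) :
  (\prod_(0 <= i < n) F i)^`() =
  \sum_(0 <= j < n) (F j)^`() * \prod_(0 <= i < n | i != j) F i.
Proof.
elim: n => [|n IHn]; first by rewrite !big_geq // derivC.
have recr j : \prod_(0 <= i < n.+1 | i != j) F i =
    \prod_(0 <= i < n | i != j) F i * (if n != j then F n else 1).
  by rewrite big_mkcond big_nat_recr //= -big_mkcond.
rewrite !big_nat_recr //= derivM IHn recr eqxx mulr1 mulr_suml.
congr (_ + _); last first.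
  rewrite mulrC; congr (_ * _); rewrite [RHS]big_mkcond.
  by apply: eq_big_nat => i /andP[_ ni]; rewrite ltn_eqF.
apply: eq_big_nat => j /andP[_ jn]; rewrite -mulrA; congr (_ * _).
by rewrite recr (gtn_eqF jn).
Qed.

(** The recursions below are those of the sections U_j(X) and U_k(-X) over F_p,
    where p - k stands for -k; the argument is purely algebraic. Formally, with
    E = V 0 * N 0, each term of the sum satisfies x c_j = E q / (q - j), so the
    hypothesis reads E q \sum_(j < p) 1 / (q - j) = 1, where the sum is the
    logarithmic derivative of the full product and equals 1 / x. As q and x
    need not be invertible, the fractions are cleared by means of the products
    M j with one factor omitted. *)
Section DescendingProducts.
Variables (A : comNzRingType) (q x : A) (V N : nat -> A) (p : nat).
Hypothesis p_odd : odd p.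
Hypothesis V_rec : forall j, (j.+1 < p)%N -> V j = - ((q - j.+1%:R) * V j.+1).
Hypothesis N_rec :
  forall k, (k.+1 < p)%N -> N k = (q - (p - k.+1)%:R) * N k.+1.

Let p_gt0 : (0 < p)%N. Proof. exact: odd_gt0. Qed.

Lemma V0_prod j : (j < p)%N ->
  V 0 = (-1) ^+ j * \prod_(1 <= i < j.+1) (q - i%:R) * V j.
Proof.
elim: j => [|j IHj] jp; first by rewrite big_geq // expr0 !mul1r.
rewrite (IHj (ltnW jp)) (V_rec jp) [in RHS]big_nat_recr //= exprS; ring.
Qed.

Lemma N0_prod k : (k < p)%N ->
  N 0 = \prod_(p - k <= i < p) (q - i%:R) * N k.
Proof.
elim: k => [|k IHk] kp; first by rewrite subn0 big_geq // mul1r.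
rewrite (IHk (ltnW kp)) (N_rec kp) [in RHS]big_ltn; last by rewrite ltn_subrL p_gt0.
by rewrite subnSK 1?ltnW //; ring.
Qed.

Lemma descending_products :
    \prod_(0 <= i < p) (q - i%:R) = - x ->
    \sum_(0 <= j < p) \prod_(0 <= i < p | i != j) (q - i%:R) = -1 ->
    V 0 * N 0 + x * \sum_(1 <= j < p) (-1) ^+ (p - j) * V j * N (p - j)%N = 1 ->
  V 0 * N 0 * q = x.
Proof.
pose M j := \prod_(0 <= i < p | i != j) (q - i%:R).
pose Pi := \prod_(1 <= i < p) (q - i%:R).
move=> prodE sumM E1; set E := V 0 * N 0 in E1 *.
have qPi : q * Pi = - x by rewrite -prodE [RHS]big_ltn // mulr0n subr0.
have M0 : M 0%N = Pi.
  rewrite /M big_ltn_cond //= big_nat_cond [RHS]big_nat_cond.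
  by apply: eq_bigl => -[].
have ME j : (j < p)%N -> (q - j%:R) * M j = - x.
  move=> jp; rewrite -prodE [RHS](bigD1_seq j) ?iota_uniq //=.
  by rewrite mem_index_iota.
pose c j := (-1) ^+ (p - j) * V j * N (p - j)%N.
(* The factors of V 0 stop at j and those of N 0 start at j, hence together
   they are all factors from 1 to p - 1, with q - j repeated. The sign comes
   from (-1)^(p - j) = - (-1)^j. *)
have Ec j : (1 <= j < p)%N -> E = - (c j * (q - j%:R) * Pi).
  case/andP=> j0 jp; rewrite /E {1}(V0_prod jp).
  have pjp : (p - j < p)%N by rewrite ltn_subrL j0.
  have jp' := ltnW jp.
  rewrite (N0_prod pjp) subKn // /c /Pi.
  rewrite big_nat_recr //= [in RHS](big_cat_nat j0 jp') /=.
  rewrite -[(-1) ^+ (p - j)]signr_odd oddB // p_odd addTb signrN.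
  rewrite signr_odd; ring.
have EPi : \sum_(0 <= j < p) M j * E = Pi.
  rewrite big_ltn // M0 -[RHS]mulr1 -E1 mulrDr; congr (_ + _).
  rewrite big_distrr big_distrr /=; apply: eq_big_nat => j j1p.
  have /andP[_ jp] := j1p.
  rewrite (Ec j j1p) -/(c j) -[x]opprK -(ME j jp); ring.
have EN : - E = Pi by rewrite -EPi -mulr_suml sumM mulN1r.
by rewrite -[E]opprK EN mulNr mulrC qPi opprK.
Qed.

End DescendingProducts.

(** * The identities modulo p *)

Section ModP.
Variables (p : nat) (p_pr : prime p).
Hypothesis p_odd : odd p.
Local Notation Zp := (zloc p).
Local Notation F := (fps 'F_p).
Local Notation red := (zloc_red p_pr).

Let p_gt0 := prime_gt0 p_pr.

Lemma fps_Fp_mulrn (f : F) : f *+ p = 0.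
Proof.
by apply/fpsP => n; rewrite fps_coefMn -[LHS]mulr_natr (pcharf0 (pchar_Fp p_pr)) mulr0.
Qed.

Lemma map_Ppoly_Fp : map_poly intr (Ppoly p) = 'X^p - 'X :> {poly 'F_p}.
Proof.
rewrite -(prod_Fp p_pr) rmorph_prod; apply: eq_bigr => j _ /=.
by rewrite rmorphB /= map_polyX map_polyC /= rmorph_nat.
Qed.

Lemma int_horner_Fp (Q : {poly int}) (s : F) :
  int_horner Q s = (map_poly (@fpsC 'F_p) (map_poly intr Q)).[s].
Proof.
rewrite -map_poly_comp; congr _.[_]; apply: eq_map_poly => c /=.
by rewrite rmorph_int.
Qed.

Lemma deriv_Xp_subX : ('X^p - 'X : {poly 'F_p})^`() = -1.
Proof.
rewrite derivB derivXn derivX -mulr_natr -polyC_natr (pcharf0 (pchar_Fp p_pr)).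
by rewrite mulr0 sub0r.
Qed.

Lemma int_horner_deriv_Ppoly (s : F) : int_horner (Ppoly p)^`() s = -1.
Proof.
by rewrite int_horner_Fp -deriv_map map_Ppoly_Fp deriv_Xp_subX rmorphN1 hornerN hornerC.
Qed.

(** Twice the divided second derivative is (X^p - X)'' = 0; here 2 is invertible
    because p is odd. *)
Lemma int_horner_nderiv2_Ppoly (s : F) : int_horner (Ppoly p)^`N(2) s = 0.
Proof.
rewrite int_horner_Fp -nderivn_map map_Ppoly_Fp.
suff -> : ('X^p - 'X : {poly 'F_p})^`N(2) = 0 by rewrite rmorph0 horner0.
have two : (2%:R : 'F_p) != 0.
  by apply: natr_Fp_neq0; rewrite // coprime_sym coprime2n.
have := nderivn_def 2 ('X^p - 'X : {poly 'F_p}).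
rewrite derivSn derivn1 deriv_Xp_subX derivN derivC oppr0 => /esym/eqP.
by rewrite -scaler_nat scaler_eq0 (negPf two) => /eqP.
Qed.

Definition AHp : F := map_fps red (AHz p_pr).
Local Notation q := (qser 'F_p p).
Local Notation U j := (sec p j AHp).

Lemma theta_AHp : theta AHp = q * AHp.
Proof.
by rewrite -map_fps_theta theta_AHz rmorphM /= map_qser.
Qed.

Lemma AHp_negX : AHp * negX AHp = 1.
Proof. by rewrite -map_fps_negX -rmorphM /= AHz_negX // rmorph1. Qed.

(** The relation P_p(q) + X = p H_p after X is replaced by -X, q being odd. *)
Lemma int_horner_opp_qser (R : comNzRingType) (v : {rmorphism int -> R}) :
  int_horner (Ppoly p) (- qser R p) = fpsX + negX (map_fps v (Hser p)) *+ p.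
Proof.
have := congr1 (fun f => negX (map_fps v f)) (Hser_exact p_pr).
rewrite !(rmorphD, rmorphMn) /= !map_int_horner /= map_qser // map_fps_X.
rewrite negX_qser // negX_fpsX => /(canRL (subrK _)) ->.
by rewrite addrC.
Qed.

(** Both sides of P_p(D) U_0 = X U_0 agree with X U_0 modulo p over Z_(p); after
    cancelling X U_0 and one factor p, the remaining equality is reduced. *)
Lemma theta_sec0 : theta (U 0) = negX (red_mod p (Hser p)) * U 0.
Proof.
pose u := sec p 0 (AHz p_pr); pose Hz : fps Zp := map_fps intr (Hser p).
have PE : int_horner (Ppoly p) (- qser Zp p) = fpsX + negX Hz *+ p.
  exact: (int_horner_opp_qser (intr : {rmorphism int -> Zp})).
have := falling_op_full p_gt0 (expand_qser Zp p_pr) (theta_AHz p_pr).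
have [r ->] := falling_op_expand p (AHz p_pr) (qser Zp p) p.
rewrite -/u PE.
set b := int_horner _ _; set c := int_horner _ _ => eq0.
have : (negX Hz * u + b * theta u - c * theta (qser Zp p) * u + r *+ p) *+ p = 0.
  by move/eqP: eq0; rewrite -subr_eq0 => /eqP <-; rewrite -/u; ring.
move=> eq0'.
have {eq0'} :
    negX Hz * u + b * theta u - c * theta (qser Zp p) * u + r *+ p = 0.
  apply/fpsP => n; apply: (@zloc_char0 _ _ p.-1).
  by rewrite prednK // -fps_coefMn eq0'.
move/(congr1 (map_fps red)); rewrite rmorphD rmorphB rmorphD rmorphMn rmorph0 /=.
rewrite fps_Fp_mulrn !rmorphM /= !map_fps_theta /b /c !map_int_horner.
rewrite int_horner_deriv_Ppoly int_horner_nderiv2_Ppoly !mul0r subr0 addr0 //.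
rewrite mulN1r map_fps_negX => /eqP; rewrite subr_eq0 => /eqP <-.
congr (negX _ * _); apply/fpsP => n /=.
by rewrite rmorph_int.
Qed.

Lemma Gser_sec : Gser p = negX (U 0).
Proof. by apply/fpsP => n; rewrite /= addn0. Qed.

Lemma theta_Gser : theta (Gser p) = red_mod p (Hser p) * Gser p.
Proof. by rewrite Gser_sec -negX_theta theta_sec0 rmorphM /= negXK. Qed.

(** The constant term is u_0 = 1. *)
Lemma Gser_unit : Gser p \is a GRing.unit.
Proof.
have AHz0 : AHz p_pr 0%N = 1 by apply: val_inj; apply: AH0.
have G0 : Gser p 0%N = 1.
  by rewrite Gser_sec -[LHS]/(1 * red (AHz p_pr 0%N)) AHz0 rmorph1 mulr1.
by rewrite -[_ \is a _]/(Gser p 0%N \is a GRing.unit) G0 unitr1.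
Qed.

Lemma Wser_Gser : Wser p = theta (Gser p) * U 0.
Proof.
apply/fpsP => k; rewrite fps_coefM -[LHS]/(Wcoef p k) /Wcoef big_mkord.
apply: eq_bigr => r _; rewrite /= addn0; congr (_ * _).
by rewrite mulrAC mulr_natr.
Qed.

(** The sum is the derivative of \prod_(i < p) (Z - i) = Z^p - Z at Z = q. *)
Lemma sum_prod_qser : \sum_(0 <= j < p) \prod_(0 <= i < p | i != j) (q - i%:R) = -1.
Proof.
pose G i : {poly F} := 'X - (i%:R)%:P.
have GE : \prod_(0 <= i < p) G i = map_poly (@fpsC 'F_p) ('X^p - 'X).
  rewrite -(prod_Fp p_pr) rmorph_prod big_mkord; apply: eq_bigr => i _ /=.
  by rewrite rmorphB /= map_polyX map_polyC /= rmorph_nat.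
have := congr1 (fun P => P^`().[q]) GE.
rewrite deriv_map deriv_Xp_subX rmorphN1 hornerN hornerC => <-.
rewrite deriv_prod horner_sum; apply: eq_bigr => j _.
rewrite derivXsubC mul1r horner_prod; apply: eq_bigr => i _.
by rewrite /G !hornerE.
Qed.

Lemma prod_qser : \prod_(0 <= i < p) (q - i%:R) = - fpsX.
Proof.
have -> : - fpsX = q ^+ p - q by rewrite -{2}(qser_expp p_pr); ring.
rewrite -(Ppoly_qser_mod p_pr) /int_horner /Ppoly rmorph_prod horner_prod big_mkord.
apply: eq_bigr => i _; rewrite -/(int_horner _ _) int_horner_XsubC //.
Qed.

Lemma secS_Fp j : (j.+1 < p)%N -> U j = - ((q - j.+1%:R) * U j.+1).
Proof.
move=> jp; rewrite -(secS_rec p_gt0 (expand_qser _ p_pr) theta_AHp jp).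
by rewrite fps_Fp_mulrn; ring.
Qed.

Lemma negX_secS_Fp k : (k.+1 < p)%N ->
  negX (U k) = (q - (p - k.+1)%:R) * negX (U k.+1).
Proof.
move=> kp; rewrite (secS_Fp kp) rmorphN rmorphM rmorphB /= negX_qser // rmorph_nat.
rewrite natrB; last exact: ltnW.
by rewrite fps_Fp_mulrn; ring.
Qed.

(** The hypothesis on the sum is the section of index zero of
    AH(X) AH(-X) = 1. *)
Lemma sec0_negX_qser : U 0 * negX (U 0) * q = fpsX.
Proof.
apply: (@descending_products _ q fpsX (fun j => U j) (fun j => negX (U j)) p).
- exact: p_odd.
- exact: secS_Fp.
- exact: negX_secS_Fp.
- exact: prod_qser.
- exact: sum_prod_qser.
have := sec0M p_gt0 AHp (negX AHp); rewrite AHp_negX (sec_negX _ _ p_odd) expr0 mul1r.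
move=> eq1; transitivity (sec p 0 (1 : F)); last first.
  apply/fpsP => n.
  by rewrite coef_sec addn0 !fps_coef1 muln_eq0 (gtn_eqF p_gt0) orbF.
rewrite eq1; congr (_ + _ * _); apply: eq_big_nat => j _.
by rewrite (sec_negX _ _ p_odd) mulrCA mulrA.
Qed.

Lemma sec0_negX_Xdivq : negX (U 0) * U 0 = Xdivq p.
Proof.
set E := negX (U 0) * U 0.
have dX1 : fps_divX q * E = 1.
  apply: fpsX_inj; rewrite mulrA fps_divXK ?qser0 // mulr1 mulrC.
  by rewrite /E (mulrC (negX _)) sec0_negX_qser.
have dU : fps_divX q \is a GRing.unit.
  by apply/unitrPr; exists E.
by rewrite /Xdivq -[LHS](mulKr dU) dX1 mulr1.
Qed.

End ModP.

Theorem theorem1p1 (p : nat) (p_prime : prime p) (p_odd : odd p) :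
  [/\ fpsX * (fps_deriv (Gser p) / Gser p) = red_mod p (Hser p),
      red_mod p (Hser p) =
        red_mod p
          (fps_divz (int_horner (Ppoly p) (qser int p) + fpsX) p%:Z),
      Wser p = Xdivq p * red_mod p (Hser p) &
      forall k : nat,
        Wcoef p k =
          (Xdivq p *
           red_mod p
             (fps_divz (int_horner (Ppoly p) (qser int p) + fpsX) p%:Z)) k].
Proof.
have WE : Wser p = Xdivq p * red_mod p (Hser p).
  rewrite (Wser_Gser p_prime) theta_Gser // (Gser_sec p_prime).
  by rewrite -mulrA sec0_negX_Xdivq // mulrC.
split=> //; last by move=> k; rewrite -[LHS]/(Wser p k) WE.
by rewrite mulrA fpsX_deriv theta_Gser // mulrK // Gser_unit.
Qed.
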